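(* Let $S\subset\mathbb N_0$ be nonempty, $\theta\in(0,1)$, let $\phi\in C^\theta(X_S)$ be a renewal-type potential with induced one-symbol potential $\psi$, let $P$ be the unique real solution of $\sum_{n\in S}e^{\psi(n)-P(n+1)}=1$, and, if $S$ is finite, assume $P>\phi(0^\infty)$. Let $\mu_\phi$ be the unique equilibrium state of $\phi$, and let $C_{\mathrm{eff}}>0$ be a constant such that $$\left|\int f\,d\mu-\int f\,d\mu_\phi\right|\le C_{\mathrm{eff}}\|f\|_\theta\sqrt{P-\left(h_\mu(\sigma)+\int\phi\,d\mu\right)}$$ for every $\sigma$-invariant Borel probability measure $\mu$ on $X_S$ and every $f\in C^\theta(X_S)$. Let $C=[w]\subset X_S$ be the cylinder determined by an admissible word $w$ of length $\ell\ge1$, and let $$\mathcal E_C=\{x\in X_S:\sigma^kx\notin C\text{ for every }k\ge0\}.$$ Assume $\mu_\phi(C)>0$. Then every $\sigma$-invariant Borel probability measure $\mu$ with $\mu(\mathcal E_C)=1$ satisfies $$P-\left(h_\mu(\sigma)+\int\phi\,d\mu\right)\ge\kappa_C,\qquad \kappa_C=\frac{\mu_\phi(C)^2}{C_{\mathrm{eff}}^2\,\|\mathbf 1_C\|_\theta^2}.$$ Consequently, $$P_{\mathrm{top}}(\mathcal E_C,\sigma,\phi)\le P-\kappa_C .$$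
   Context: $\mathbb N_0=\{0,1,2,\dots\}$. For nonempty $S\subset\mathbb N_0$, the one-sided $S$-gap shift $X_S\subset\{0,1\}^{\mathbb N_0}$ is the set of all $x=(x_k)_{k\ge0}$ such that whenever two consecutive (i.e. successive) symbols $1$ occur in $x$, the number of zeros between them belongs to $S$; it contains $0^\infty=000\cdots$, and $\sigma$ is the left shift. For $\theta\in(0,1)$ put $d_\theta(x,y)=\theta^{t(x,y)}$, $t(x,y)=\min\{k\ge0:x_k\ne y_k\}$, $d_\theta(x,x)=0$. $C^\theta(X_S)$ is the space of bounded real functions with $\|f\|_\theta=\|f\|_\infty+|f|_\theta<\infty$, where $|f|_\theta=\sup_{x\ne y}|f(x)-f(y)|/d_\theta(x,y)$. Cylinders: $[w]=\{x\in X_S:x_0\cdots x_{\ell-1}=w\}$; $\mathbf 1_C$ is the indicator of $C$. Let $Y_S=S^{\mathbb N_0}$, $\pi(y)=10^{y_0}10^{y_1}10^{y_2}\cdots\in X_S$ and $\tau(y)=y_0+1$ for $y\in Y_S$. A potential $\phi\in C^\theta(X_S)$ is renewal-type, with induced one-symbol potential $\psi:S\to\mathbb R$, if $\sum_{j=0}^{\tau(y)-1}\phi(\sigma^j\pi(y))=\psi(y_0)$ for all $y\in Y_S$. Under the stated hypotheses, $P=P_{\mathrm{top}}(X_S,\sigma,\phi)=\sup_\mu\{h_\mu(\sigma)+\int\phi\,d\mu\}$ (supremum over $\sigma$-invariant Borel probability measures), $\phi$ has a unique equilibrium state (invariant measure attaining the supremum), and a constant $C_{\mathrm{eff}}$ as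 in the claim exists. The pressure $P_{\mathrm{top}}(\mathcal E_C,\sigma,\phi)$ is computed as the supremum of $h_\mu(\sigma)+\int\phi\,d\mu$ over $\sigma$-invariant Borel probability measures $\mu$ with $\mu(\mathcal E_C)=1$ (equal to $-\infty$ if there are none). *)

(* Defs.v *)
From HB Require Import structures.
From mathcomp Require Import all_boot all_order all_algebra.
From mathcomp Require Import all_classical all_reals all_analysis.

Set Implicit Arguments.
Unset Strict Implicit.
Unset Printing Implicit Defensive.

Import Order.TTheory GRing.Theory Num.Theory.
Import numFieldNormedType.Exports.

Local Open Scope classical_set_scope.
Local Open Scope ring_scope.

(* [true] is the symbol 1; two occurrences of 1 are successive when only zeros
   stand strictly between them. *)
Definition gap_shift (S : set nat) : set cantor_space :=
  [set x : cantor_space | forall i j : nat, (i < j)%N -> x i -> x j ->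
     (forall k : nat, (i < k < j)%N -> ~~ x k) -> S (j - i.+1)%N].

Definition gap_space (S : set nat) : Type := gap_shift S.

Definition symb (S : set nat) (x : gap_space S) (k : nat) : bool :=
  (val x : cantor_space) k.

Lemma gap_shift_zeros (S : set nat) : gap_shift S (fun=> false).
Proof. by []. Qed.

Definition zeros (S : set nat) : gap_space S := SigSub (mem_set (@gap_shift_zeros S)).

HB.instance Definition _ (S : set nat) := Topological.on (gap_space S).
HB.instance Definition _ (S : set nat) := isPointed.Build (gap_space S) (zeros S).
(* Borel sigma-algebra of the subspace topology inherited from the product
   topology, which is also the topology of every [gap_dist theta] below. *)
HB.instance Definition _ (S : set nat) := Measurable.copy (gap_space S)
  (g_sigma_algebraType (@open (gap_space S))).

Lemma gap_shift_shift (S : set nat) (x : gap_space S) :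
  gap_shift S (fun k => symb x k.+1).
Proof.
have xS : gap_shift S (val x) by exact: set_valP.
move=> i j ij xi xj no1; rewrite -[(j - _)%N]subSS; apply: xS => // -[//|k].
exact: no1.
Qed.

Definition left_shift (S : set nat) (x : gap_space S) : gap_space S :=
  SigSub (mem_set (@gap_shift_shift S x)).

Definition gap_dist (R : realType) (theta : R) (S : set nat)
    (x y : gap_space S) : R :=
  if pselect (exists k : nat, symb x k != symb y k) is left xy
  then theta ^+ ex_minn xy else 0.

Definition sup_norm (R : realType) (S : set nat) (f : gap_space S -> R) : \bar R :=
  ereal_sup [set (`|f x|)%:E | x in [set: gap_space S]].

Definition holder_seminorm (R : realType) (theta : R) (S : set nat)
    (f : gap_space S -> R) : \bar R :=
  ereal_sup [set (`|f xy.1 - f xy.2| / gap_dist theta xy.1 xy.2)%:E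
            | xy in [set xy : gap_space S * gap_space S | xy.1 <> xy.2]].

Definition holder_norm (R : realType) (theta : R) (S : set nat)
    (f : gap_space S -> R) : \bar R :=
  (sup_norm f + holder_seminorm theta f)%E.

Definition holder (R : realType) (theta : R) (S : set nat)
    (f : gap_space S -> R) : Prop :=
  (holder_norm theta f < +oo)%E.

Definition invariant_measure (d : measure_display) (T : measurableType d)
    (R : realType) (f : T -> T) (mu : probability T R) : Prop :=
  forall A : set T, measurable A -> mu (f @^-1` A) = mu A.

(* The atoms of the join of the preimages of the partition [F] under
   [f^0, ..., f^(n-1)] are indexed by words of length [n]; [ln 0 = 0], so that
   null atoms contribute 0. *)
Definition join_entropy (d : measure_display) (T : measurableType d)
    (R : realType) (f : T -> T) (mu : probability T R)
    (k : nat) (F : 'I_k -> set T) (n : nat) : R :=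
  \sum_(u : {ffun 'I_n -> 'I_k})
    let m := fine (mu (\bigcap_(i in [set: 'I_n]) (iter i f @^-1` F (u i)))) in
    - (m * ln m).

(* The limit exists, by subadditivity, when [mu] is [f]-invariant. *)
Definition partition_entropy (d : measure_display) (T : measurableType d)
    (R : realType) (f : T -> T) (mu : probability T R)
    (k : nat) (F : 'I_k -> set T) : R :=
  limn (fun n : nat => join_entropy f mu F n / n%:R).

Definition ks_entropy (d : measure_display) (T : measurableType d)
    (R : realType) (f : T -> T) (mu : probability T R) : \bar R :=
  ereal_sup [set h : \bar R | exists (k : nat) (F : 'I_k -> set T),
    [/\ forall i : 'I_k, measurable (F i),
        partition [set: 'I_k] F [set: T]
      & h = (partition_entropy f mu F)%:E]].

Definition free_energy (R : realType) (S : set nat) (phi : gap_space S -> R)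
    (mu : probability (gap_space S) R) : \bar R :=
  (ks_entropy (@left_shift S) mu + \int[mu]_x (phi x)%:E)%E.

(* [ereal_sup set0 = -oo]; for [E = setT] the constraint [mu E = 1] always holds. *)
Definition pressure (R : realType) (S : set nat) (phi : gap_space S -> R)
    (E : set (gap_space S)) : \bar R :=
  ereal_sup [set free_energy phi mu | mu in
    [set mu : probability (gap_space S) R |
      invariant_measure (@left_shift S) mu /\ mu E = 1%E]].

Definition equilibrium_state (R : realType) (S : set nat)
    (phi : gap_space S -> R) (mu : probability (gap_space S) R) : Prop :=
  invariant_measure (@left_shift S) mu /\
  free_energy phi mu = pressure phi [set: gap_space S].

(* Values of [probability] objects off the sigma-algebra are irrelevant, so
   uniqueness is equality on measurable sets, not Leibniz equality. *)
Definition unique_equilibrium_state (R : realType) (S : set nat)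
    (phi : gap_space S -> R) (mu : probability (gap_space S) R) : Prop :=
  equilibrium_state phi mu /\
  forall nu : probability (gap_space S) R, equilibrium_state phi nu ->
    forall A : set (gap_space S), measurable A -> nu A = mu A.

(* Position of the [n]-th symbol 1 (counted from 0) in
   1 0^(y 0) 1 0^(y 1) 1 0^(y 2) ... *)
Definition renewal_time (S : set nat) (y : nat -> S) (n : nat) : nat :=
  (\sum_(i < n) (val (y i)).+1)%N.

Definition renewal_seq (S : set nat) (y : nat -> S) : cantor_space :=
  fun k : nat => `[< exists n : nat, k = renewal_time y n >].

Lemma renewal_timeS (S : set nat) (y : nat -> S) (n : nat) :
  renewal_time y n.+1 = (renewal_time y n + (val (y n)).+1)%N.
Proof. by rewrite /renewal_time big_ord_recr. Qed.

Lemma renewal_time_le (S : set nat) (y : nat -> S) (m n : nat) :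
  (m <= n)%N -> (renewal_time y m <= renewal_time y n)%N.
Proof.
elim: n => [|n IHn]; first by rewrite leqn0 => /eqP ->.
rewrite leq_eqVlt => /predU1P[-> //|]; rewrite ltnS => /IHn mn.
by rewrite renewal_timeS (leq_trans mn)// leq_addr.
Qed.

Lemma gap_shift_renewal (S : set nat) (y : nat -> S) :
  gap_shift S (renewal_seq y).
Proof.
move=> i j ij /asboolP[n iE] /asboolP[m jE] no1.
have nm : (n < m)%N.
  by rewrite ltnNge; apply/negP => /(renewal_time_le y); rewrite -iE -jE leqNgt ij.
have := renewal_time_le y nm; rewrite -jE leq_eqVlt => /predU1P[jE'|lt_j].
  by rewrite -jE' renewal_timeS iE addnS subSS addKn; exact: set_valP.
have /no1/negP[] : (i < renewal_time y n.+1 < j)%N.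
  by rewrite lt_j renewal_timeS iE addnS ltnS leq_addr.
by apply/asboolP; exists n.+1.
Qed.

Definition renewal_point (S : set nat) (y : nat -> S) : gap_space S :=
  SigSub (mem_set (@gap_shift_renewal S y)).

Definition renewal_type (R : realType) (S : set nat)
    (phi : gap_space S -> R) (psi : S -> R) : Prop :=
  forall y : nat -> S,
    \sum_(0 <= j < (val (y 0%N)).+1) phi (iter j (@left_shift S) (renewal_point y))
      = psi (y 0%N).

Definition renewal_equation (R : realType) (S : set nat) (psi : S -> R)
    (P : R) : Prop :=
  (\esum_(n in [set: S]) (expR (psi n - P * (val n).+1%:R))%:E = 1)%E.

Definition admissible (S : set nat) (w : seq bool) : Prop :=
  exists (x : gap_space S) (k : nat),
    forall i : nat, (i < size w)%N -> symb x (k + i)%N = nth false w i.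

Definition cylinder (S : set nat) (w : seq bool) : set (gap_space S) :=
  [set x | forall i : nat, (i < size w)%N -> symb x i = nth false w i].

Definition escape_set (S : set nat) (C : set (gap_space S)) :
    set (gap_space S) :=
  [set x | forall k : nat, ~ C (iter k (@left_shift S) x)].

(* The Hoelder norm of the indicator of a cylinder is finite and at least 1
   when the cylinder is nonempty, so [fine] loses nothing. *)
Definition kappa (R : realType) (theta : R) (S : set nat) (Ceff : R)
    (mu : probability (gap_space S) R) (C : set (gap_space S)) : R :=
  fine (mu C) ^+ 2 /
  (Ceff ^+ 2 * fine (holder_norm theta (\1_C : gap_space S -> R)) ^+ 2).

(* Main.v *)
Require Import Defs.
From mathcomp Require Import all_boot all_order all_algebra.
From mathcomp Require Import all_classical all_reals all_analysis.

Import Order.TTheory GRing.Theory Num.Theory.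

Local Open Scope classical_set_scope.
Local Open Scope ring_scope.

(** The escape gap is the transport inequality tested on a single function, the
    indicator of the hole [C].

    Finitely many symbols decide membership in a cylinder, so its indicator is
    Hoelder ([holder_indic_cylinder]), hence an admissible test function.  If an invariant [mu] gives full mass to
    the points whose orbit never meets [C], then [mu C = 0]
    ([escape_null_hole]), so the two integrals of the indicator differ by
    exactly [mu_phi C]: with [D = P - (h_mu + int phi dmu)],

      mu_phi C <= Ceff * ||1_C|| * sqrt D.

    Because the left-hand side is positive, every factor on the right must be
    positive, and squaring gives [D >= kappa] ([sqr_le_of_le_mul_sqrte]).  The
    bound on the pressure is the supremum of this inequality over [mu]. *)

Lemma symb_iter_shift (S : set nat) (x : gap_space S) (k i : nat) :
  symb (iter k (@left_shift S) x) i = symb x (k + i).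
Proof.
elim: k i => [//|k IHk] i; rewrite iterS.
by rewrite [LHS](IHk i.+1) addnS addSn.
Qed.

(** Reading off one symbol is continuous into a discrete space. *)
Lemma measurable_symb (S : set nat) (k : nat) (b : bool) :
  measurable [set x : gap_space S | symb x k = b].
Proof.
apply: sub_sigma_algebra.
have val_cont : continuous (val : gap_space S -> cantor_space).
  exact: initial_continuous.
have k_cont : continuous (fun x : gap_space S => symb x k).
  move=> x; apply: (@continuous_comp _ _ _ _ (fun y : cantor_space => y k)).
    exact: val_cont.
  exact: (@proj_continuous nat (fun=> bool) k).
by move/continuousP : k_cont => /(_ [set b]); apply; exact: discrete_open.
Qed.

Lemma measurable_iter_shift_cylinder (S : set nat) (w : seq bool) (k : nat) :
  measurable (iter k (@left_shift S) @^-1` cylinder w).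
Proof.
rewrite (_ : _ @^-1` _ = \bigcap_(i in `I_(size w))
    [set x | symb x (k + i) = nth false w i]).
  by apply: fin_bigcap_measurable => // i _; exact: measurable_symb.
by apply/seteqP; split => x xw i iw; have := xw i iw; rewrite /= symb_iter_shift.
Qed.

Lemma measurable_cylinder (S : set nat) (w : seq bool) :
  measurable (cylinder w : set (gap_space S)).
Proof. exact: (@measurable_iter_shift_cylinder S w 0). Qed.

Lemma measurable_escape_cylinder (S : set nat) (w : seq bool) :
  measurable (escape_set (cylinder w) : set (gap_space S)).
Proof.
rewrite (_ : escape_set _ =
    \bigcap_k ~` (iter k (@left_shift S) @^-1` cylinder w)).
  apply: bigcapT_measurable => k; apply: measurableC; exact: measurable_iter_shift_cylinder.
by apply/seteqP; split => x xE k => [_|]; exact: xE.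
Qed.

(** Time 0 alone suffices: the escape set lies in the complement of the hole,
    and being Borel it passes its full mass on to that complement. *)
Lemma escape_null_hole (R : realType) (S : set nat) (w : seq bool)
    (mu : probability (gap_space S) R) :
  mu (escape_set (cylinder w)) = 1%E -> mu (cylinder w) = 0%E.
Proof.
move=> muE; have mE := @measurable_escape_cylinder S w.
have muEC : mu (~` escape_set (cylinder w)) = 0%E.
  by rewrite probability_setC// muE subee.
apply: (@subset_measure0 _ _ _ mu _ (~` escape_set (cylinder w))).
- exact: measurable_cylinder.
- exact: measurableC.
- by move=> x xC /(_ 0%N).
- exact: muEC.
Qed.

(** Membership in the cylinder depends on the first [size w] symbols only, which
    is what makes its indicator Lipschitz with constant [theta ^- size w]. *)
Lemma gap_dist_ge (R : realType) (theta : R) (S : set nat) (w : seq bool)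
    (x y : gap_space S) : 0 < theta < 1 ->
  cylinder w x -> ~ cylinder w y -> theta ^+ size w <= gap_dist theta x y.
Proof.
move=> /andP[t0 t1] xw yw.
have [k kw xyk] : exists2 k, (k < size w)%N & symb x k != symb y k.
  apply: contrapT => H; apply: yw => i iw; rewrite -(xw i iw).
  by apply/eqP; apply: contrapT => /negP ne; apply: H; exists i; rewrite // eq_sym.
rewrite /gap_dist; case: pselect => [xy|[]]; last by exists k.
case: ex_minnP => m _ /(_ _ xyk) mk.
by apply: ler_wiXn2l; [exact: ltW | exact: ltW | exact: leq_trans mk (ltnW kw)].
Qed.

Lemma gap_distC (R : realType) (theta : R) (S : set nat) (x y : gap_space S) :
  gap_dist theta x y = gap_dist theta y x.
Proof.
rewrite /gap_dist; case: pselect => [xy|nxy]; case: pselect => [yx|nyx] //.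
- by congr (_ ^+ _); apply: eq_ex_minn => k; rewrite eq_sym.
- by case: nyx; case: xy => k; rewrite eq_sym; exists k.
- by case: nxy; case: yx => k; rewrite eq_sym; exists k.
Qed.

Lemma holder_indic_cylinder (R : realType) (theta : R) (S : set nat)
    (w : seq bool) : 0 < theta < 1 ->
  holder theta (\1_(cylinder w) : gap_space S -> R).
Proof.
move=> t01; have t0 : 0 < theta by case/andP: t01.
rewrite /holder /holder_norm; apply: lte_add_pinfty.
- apply: (@le_lt_trans _ _ 1%:E); last exact: ltry.
  apply: ge_ereal_sup => _ [x _ <-].
  by rewrite lee_fin indicE; case: (_ \in _); rewrite ?normr1 ?normr0.
- apply: (@le_lt_trans _ _ ((theta ^+ size w)^-1)%:E); last exact: ltry.
  have tw : 0 < theta ^+ size w by rewrite exprn_gt0.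
  apply: ge_ereal_sup => _ [[x y] /= _ <-]; rewrite lee_fin !indicE.
  have [/set_mem xw|/negP nxw] := boolP (x \in cylinder w);
    have [/set_mem yw|/negP nyw] := boolP (y \in cylinder w).
  + by rewrite subrr normr0 mul0r invr_ge0 ltW.
  + have dw : theta ^+ size w <= gap_dist theta x y.
      by apply: gap_dist_ge => // yw; apply: nyw; exact: mem_set.
    by rewrite subr0 normr1 mul1r lef_pV2// posrE (lt_le_trans tw).
  + have dw : theta ^+ size w <= gap_dist theta x y.
      by rewrite gap_distC; apply: gap_dist_ge => // xw; apply: nxw; exact: mem_set.
    by rewrite sub0r normrN normr1 mul1r lef_pV2// posrE (lt_le_trans tw).
  + by rewrite subrr normr0 mul0r invr_ge0 ltW.
Qed.

(** Positivity of [m] excludes all degenerate values on the right: it forces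
    [N] to be a positive real and [D] to be positive (possibly [+oo]), so that
    the inequality can be squared. *)
Lemma sqr_le_of_le_mul_sqrte (R : realType) (m c : R) (N D : \bar R) :
  0 < m -> 0 < c -> (N < +oo)%E ->
  (m%:E <= c%:E * N * sqrte D)%E ->
  ((m ^+ 2 / (c ^+ 2 * fine N ^+ 2))%:E <= D)%E.
Proof.
move=> m0 c0 Noo mle.
have pos : (0 < c%:E * N * sqrte D)%E by apply: lt_le_trans mle; rewrite lte_fin.
have N0 : (0 < N)%E.
  rewrite ltNge; apply/negP => N0; move: pos; rewrite ltNge => /negP; apply.
  by rewrite mule_le0_ge0 ?sqrte_ge0// mule_ge0_le0// lee_fin ltW.
case: N N0 Noo mle pos => [N| |]//; rewrite lte_fin => N0 _.
have cN0 : 0 < c * N by rewrite mulr_gt0.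
case: D => [d| |] /=; [|by rewrite leey|by rewrite mule0 lee_fin leNgt m0].
rewrite -!EFinM !lee_fin lte_fin => mle pos.
have d0 : 0 < d by move: pos; rewrite pmulr_rgt0// sqrtr_gt0.
rewrite -exprMn ler_pdivrMr ?exprn_gt0// -[X in X * _]sqr_sqrtr; last exact: ltW.
by rewrite -exprMn mulrC ler_sqr// nnegrE ltW.
Qed.

Theorem proposition7p2 (R : realType) (S : set nat) (theta : R)
    (phi : gap_space S -> R) (psi : S -> R) (P : R)
    (mu_phi : probability (gap_space S) R) (Ceff : R) (w : seq bool)
    (hS : S !=set0)
    (htheta : 0 < theta < 1)
    (hphi : holder theta phi)
    (hpsi : renewal_type phi psi)
    (hP : renewal_equation psi P)
    (hPuniq : forall Q : R, renewal_equation psi Q -> Q = P)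
    (hfin : finite_set S -> phi (zeros S) < P)
    (hmu_phi : unique_equilibrium_state phi mu_phi)
    (hCeff_gt0 : 0 < Ceff)
    (hCeff : forall (mu : probability (gap_space S) R) (f : gap_space S -> R),
       invariant_measure (@left_shift S) mu -> holder theta f ->
       (`|\int[mu]_x (f x)%:E - \int[mu_phi]_x (f x)%:E| <=
         Ceff%:E * holder_norm theta f * sqrte (P%:E - free_energy phi mu))%E)
    (hw : (1 <= size w)%N)
    (hadm : admissible S w)
    (hC : (0 < mu_phi (cylinder w))%E) :
  (forall mu : probability (gap_space S) R,
     invariant_measure (@left_shift S) mu ->
     mu (escape_set (cylinder w)) = 1%E ->
     ((kappa theta Ceff mu_phi (cylinder w))%:E <=
       P%:E - free_energy phi mu)%E) /\
  (pressure phi (escape_set (cylinder w)) <=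
     (P - kappa theta Ceff mu_phi (cylinder w))%:E)%E.
Proof.
set C := cylinder w in hC *; set K := kappa _ _ _ _.
have mC : measurable C by exact: measurable_cylinder.
have int_C (nu : probability (gap_space S) R) :
    (\int[nu]_x (\1_C x : R)%:E = nu C)%E.
  by rewrite integral_indic// setIT.
have gap (mu : probability (gap_space S) R) :
    invariant_measure (@left_shift S) mu -> mu (escape_set C) = 1%E ->
    (K%:E <= P%:E - free_energy phi mu)%E.
  move=> mu_inv muE.
  have muC0 : mu C = 0%E by exact: escape_null_hole.
  have C_holder := @holder_indic_cylinder R theta S w htheta.
  have muC_fin := fin_num_measure mu_phi C mC.
  apply: sqr_le_of_le_mul_sqrte => //.
  - by rewrite fine_gt0// hC ltey_eq muC_fin.
  - have := hCeff mu _ mu_inv C_holder.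
    rewrite !int_C muC0.
    by rewrite sub0e abseN gee0_abs ?measure_ge0// fineK.
split=> //; apply: ge_ereal_sup => _ [mu [mu_inv muE] <-].
have := gap mu mu_inv muE.
case: (free_energy phi mu) => [F| |] //=; last by rewrite leNye.
by rewrite -EFinB !lee_fin !lerBrDr addrC.
Qed.
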